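(* Let $n$ be a positive integer and let $T\colon M_n\rightarrow M_n$ be a group invertible linear operator. If $T$ preserves Hadamard circulant majorization, then so does its group inverse $T^{\#}$.
   Context: $M_n$ is the real vector space of all $n\times n$ real matrices, and $\mathbb{N}_n=\{1,\ldots,n\}$. Let $C:=[\mathbf{e}_n,\mathbf{e}_1,\ldots,\mathbf{e}_{n-1}]$ be the $n\times n$ matrix with the indicated columns, where $\mathbf{e}_i$ is the $i$th standard basis vector of $\mathbb{R}^n$; for $i\in\mathbb{N}_n$ put $C_i:=C^i$ (the $i$th power). A matrix in $M_n$ is called circulant doubly stochastic if it is a convex combination of $C_1,\ldots,C_n$. For $X=[x_{ij}],Y=[y_{ij}]\in M_n$, the Hadamard product is $X\odot Y:=[x_{ij}y_{ij}]$. We write $X\prec_{HC}Y$ ($X$ is Hadamard circulant majorized by $Y$) if there is a circulant doubly stochastic matrix $D\in M_n$ with $X=D\odot Y$. A linear operator $T\colon M_n\to M_n$ preserves Hadamard circulant majorization if $T(X)\prec_{HC}T(Y)$ whenever $X\prec_{HC}Y$. A linear operator $T\colon M_n\to M_n$ is group invertible if there exists a linear operator $U\colon M_n\to M_n$ with $TUT=T$, $UTU=U$ and $UT=TU$; such a $U$ is then unique, is called the group inverse of $T$, and is denoted by $T^{\#}$. *)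

(* Defs.v *)
From HB Require Import structures.
From mathcomp Require Import all_boot all_order all_algebra.
From mathcomp Require Import boolp reals.

Set Implicit Arguments.
Unset Strict Implicit.
Unset Printing Implicit Defensive.

Import Order.TTheory GRing.Theory Num.Theory.
Local Open Scope ring_scope.

Section HadamardCirculant.
Variables (R : realType) (n : nat).

(* Indices run over 0..n-1, and ord_pred is the cyclic predecessor: column 0
   is the last standard basis vector and column j > 0 is the (j-1)-th one. *)
Definition circ_shift : 'M[R]_n := \matrix_(i, j) (i == ord_pred j)%:R.

(* i : 'I_n stands for the exponent i.+1, which ranges over 1..n. *)
Definition circulant_ds (D : 'M[R]_n) : Prop :=
  exists a : 'I_n -> R,
    [/\ forall i, 0 <= a i,
        \sum_(i < n) a i = 1
      & D = \sum_(i < n) a i *: circ_shift ^+ i.+1].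

Definition hadamard (X Y : 'M[R]_n) : 'M[R]_n := map2_mx *%R X Y.

Definition hc_maj (X Y : 'M[R]_n) : Prop :=
  exists2 D : 'M[R]_n, circulant_ds D & X = hadamard D Y.

Definition preserves_hc_maj (T : {linear 'M[R]_n -> 'M[R]_n}) : Prop :=
  forall X Y : 'M[R]_n, hc_maj X Y -> hc_maj (T X) (T Y).

End HadamardCirculant.

Section GroupInverse.
Variables (R : realType) (n : nat).
Implicit Types T U V : {linear 'M[R]_n -> 'M[R]_n}.

Definition is_group_inverse T U : Prop :=
  [/\ T \o U \o T =1 T, U \o T \o U =1 U & U \o T =1 T \o U].

Definition group_invertible T : Prop :=
  exists U : {linear 'M[R]_n -> 'M[R]_n}, is_group_inverse T U.

(* The chosen witness does not depend on the choice: see group_inverse_uniq. *)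
Definition group_inverse T (hT : group_invertible T) :
  {linear 'M[R]_n -> 'M[R]_n} := projT1 (cid hT).

Lemma group_inverseP T (hT : group_invertible T) :
  is_group_inverse T (group_inverse hT).
Proof. exact: (projT2 (cid hT)). Qed.

Lemma group_inverse_uniq T U V :
  is_group_inverse T U -> is_group_inverse T V -> U =1 V.
Proof.
move=> [TUT UTU UT] [TVT VTV VT] X.
have {}TUT Z : T (U (T Z)) = T Z := TUT Z.
have {}UTU Z : U (T (U Z)) = U Z := UTU Z.
have {}UT Z : U (T Z) = T (U Z) := UT Z.
have {}TVT Z : T (V (T Z)) = T Z := TVT Z.
have {}VTV Z : V (T (V Z)) = V Z := VTV Z.
have {}VT Z : V (T Z) = T (V Z) := VT Z.
have TUTV Z : T (U Z) = T (V Z).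
  by rewrite -(TUT (V Z)) -VT -(UT (V (T Z))) TVT UT.
by rewrite -UTU TUTV UT TUTV -VT VTV.
Qed.

End GroupInverse.

(* Main.v *)
(** Split M_n as the direct sum of the subspaces of matrices supported on the
    cyclic diagonals. Hadamard multiplication by a circulant doubly stochastic
    matrix acts on the k-th summand as a scalar a_k, where a is a probability
    vector. With respect to this decomposition, T preserves Hadamard circulant
    majorization iff each row and each column of its block matrix contains at
    most one nonzero block. Then the image and the kernel of T are graded, so if
    T has a group inverse U, the (k, l) block of U can only be nonzero when the
    (l, k) block of T is. Hence U has the same sparsity property. *)
Require Import Defs.
From HB Require Import structures.
From mathcomp Require Import all_boot all_order all_algebra.
From mathcomp Require Import boolp reals.

Set Implicit Arguments.
Unset Strict Implicit.
Unset Printing Implicit Defensive.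

Import Order.TTheory GRing.Theory Num.Theory.
Local Open Scope ring_scope.

(** * Cyclic diagonals and powers of the shift *)

Lemma iter_ord_pred_modn (n m : nat) (j : 'I_n) :
  iter m (@ord_pred n) j + m = j %[mod n].
Proof.
elim: m j => [|m IHm] j; first by rewrite addn0.
rewrite iterSr addnS -addn1 -modnDml IHm modnDml /= modnDml addn1 prednK.
  by rewrite modnDr.
by rewrite addn_gt0 (leq_ltn_trans _ (ltn_ord j)) ?orbT.
Qed.

(** Modulo n, the iterate determines the exponent, and [k.+1] meets each residue class only once. *)
Lemma iter_ord_pred_inj (n : nat) (j : 'I_n) :
  injective (fun k : 'I_n => iter k.+1 (@ord_pred n) j).
Proof.
move=> k k' eq_kk'; apply/val_inj.
have := iter_ord_pred_modn k.+1 j; rewrite eq_kk'.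
rewrite -(iter_ord_pred_modn k'.+1 j) => /eqP.
rewrite eqn_modDl -[k.+1]addn1 -[k'.+1]addn1 eqn_modDr.
by rewrite !modn_small // => /eqP.
Qed.

(** The cyclic diagonal through [(i, j)]: among the powers [k.+1] of the shift, exactly the one with
    this [k] has a nonzero entry there. *)
Definition diag_index (n : nat) (i j : 'I_n) : 'I_n :=
  invF (@iter_ord_pred_inj n j) i.

Lemma circ_shiftXE (R : realType) (n m : nat) (i j : 'I_n) :
  (circ_shift R n ^+ m) i j = (i == iter m (@ord_pred n) j)%:R.
Proof.
elim: m i j => [|m IHm] i j; first by rewrite expr0 mxE.
rewrite exprSr mxE (bigD1 (ord_pred j)) //= IHm mxE eqxx mulr1 -iterS iterSr.
rewrite big1 ?addr0 // => k neq_k; rewrite [X in _ * X]mxE (negbTE neq_k).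
by rewrite mulr0.
Qed.

Lemma circ_shiftSE (R : realType) (n : nat) (k i j : 'I_n) :
  (circ_shift R n ^+ k.+1) i j = (diag_index i j == k)%:R.
Proof.
rewrite circ_shiftXE; congr (nat_of_bool _)%:R.
apply/eqP/eqP => [->|<-]; first exact: (invF_f (@iter_ord_pred_inj n j)).
exact: (esym (f_invF (@iter_ord_pred_inj n j) i)).
Qed.

Definition prob_vector (R : realType) (n : nat) (a : 'I_n -> R) : Prop :=
  (forall i, 0 <= a i) /\ \sum_(i < n) a i = 1.

Lemma hc_majP (R : realType) (n : nat) (X Y : 'M[R]_n) :
  hc_maj X Y <-> exists2 a : 'I_n -> R,
    prob_vector a & forall i j, X i j = a (diag_index i j) * Y i j.
Proof.
have coefE (a : 'I_n -> R) i j :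
    (\sum_k a k *: circ_shift R n ^+ k.+1) i j = a (diag_index i j).
  rewrite summxE (bigD1 (diag_index i j)) //= mxE circ_shiftSE eqxx mulr1.
  rewrite big1 ?addr0 // => k neq_k.
  by rewrite mxE circ_shiftSE eq_sym (negbTE neq_k) mulr0.
split=> [[D [a [a_ge0 a_sum ->]] ->]|[a [a_ge0 a_sum] XE]].
  by exists a => // i j; rewrite mxE coefE.
exists (\sum_k a k *: circ_shift R n ^+ k.+1); first by exists a.
by apply/matrixP => i j; rewrite XE mxE coefE.
Qed.

(** * The grading of the matrix space by cyclic diagonals *)

Section DiagonalBlocks.
Variables (R : realType) (n : nat).
Implicit Types (T U : {linear 'M[R]_n -> 'M[R]_n}) (X Y : 'M[R]_n).

Definition diag_part (k : 'I_n) X : 'M[R]_n :=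
  \matrix_(i, j) ((diag_index i j == k)%:R * X i j).

Lemma diag_part_is_linear k : linear (diag_part k).
Proof.
by move=> c X Y; apply/matrixP => i j; rewrite !mxE mulrDr mulrCA.
Qed.

HB.instance Definition _ k := GRing.isLinear.Build R 'M[R]_n 'M[R]_n _
  (diag_part k) (diag_part_is_linear k).

Lemma diag_partK k X : diag_part k (diag_part k X) = diag_part k X.
Proof.
by apply/matrixP => i j; rewrite !mxE; case: eqP; rewrite ?mul1r ?mul0r.
Qed.

Lemma diag_part_neq k l X : k != l -> diag_part k (diag_part l X) = 0.
Proof.
move=> neq_kl; apply/matrixP => i j; rewrite !mxE.
case: eqP => [->|_]; last by rewrite mul0r.
by rewrite (negbTE neq_kl) mul0r mulr0.
Qed.

Lemma sum_diag_part X : X = \sum_k diag_part k X.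
Proof.
apply/matrixP => i j; rewrite summxE (bigD1 (diag_index i j)) //=.
rewrite mxE eqxx mul1r big1 ?addr0 // => k neq_k.
by rewrite mxE eq_sym (negbTE neq_k) mul0r.
Qed.

Lemma diag_part_eqP X Y : (forall k, diag_part k X = diag_part k Y) -> X = Y.
Proof.
by move=> eqXY; rewrite [X]sum_diag_part [Y]sum_diag_part; apply: eq_bigr.
Qed.

Lemma hc_maj_partP X Y :
  hc_maj X Y <-> exists2 a : 'I_n -> R,
    prob_vector a & forall k, diag_part k X = a k *: diag_part k Y.
Proof.
rewrite hc_majP; split=> -[a a_prob XE]; exists a => //.
  move=> k; apply/matrixP => i j; rewrite !mxE XE.
  by case: eqP => [<-|_]; rewrite ?mul1r // !mul0r mulr0.
move=> i j; have /matrixP/(_ i j) := XE (diag_index i j).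
by rewrite !mxE eqxx !mul1r.
Qed.

Definition block T (l k : 'I_n) : bool :=
  `[< exists X, diag_part l (T (diag_part k X)) != 0 >].

Lemma block0 T l k X :
  ~~ block T l k -> diag_part l (T (diag_part k X)) = 0.
Proof.
by move=> /asboolPn nb; apply/eqP; apply: contra_notT nb => nz; exists X.
Qed.

Definition monomial_blocks T : Prop :=
  (forall l k m, block T l k -> block T l m -> k = m) /\
  (forall k l m, block T l k -> block T m k -> l = m).

(** * Preservation forces monomial blocks *)

Lemma prob_vector1 k : prob_vector (fun m : 'I_n => (m == k)%:R : R).
Proof.
split=> [m|]; first by rewrite ler0n.
by rewrite (bigD1 k) //= eqxx big1 ?addr0 // => m /negbTE ->.
Qed.

Lemma hc_maj_diag_part k Y : hc_maj (diag_part k Y) Y.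
Proof.
apply/hc_maj_partP; exists (fun m => (m == k)%:R); first exact: prob_vector1.
move=> m; have [->|neq_mk] := eqVneq m k; first by rewrite diag_partK scale1r.
by rewrite diag_part_neq // scale0r.
Qed.

(** If [k != m], then [diag_part k X] is majorized by [diag_part k X + c *: diag_part m Y] for every
    [c]. Hence [u] is a multiple of [u + c *: v] for all [c], which is impossible when [u] and [v]
    are both nonzero. *)
Lemma monomial_blocks_row T l k m : preserves_hc_maj T ->
  block T l k -> block T l m -> k = m.
Proof.
move=> presT /asboolP[X nzX] /asboolP[Y nzY]; apply/eqP.
apply: contraT => neq_km.
set u := diag_part l (T (diag_part k X)) in nzX.
set v := diag_part l (T (diag_part m Y)) in nzY.
have absorb (c : R) : exists b : R, u = b *: (u + c *: v).
  have /presT/hc_maj_partP[b _ /(_ l) bE] :=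
    hc_maj_diag_part k (diag_part k X + c *: diag_part m Y).
  exists (b l); move: bE; rewrite !linearD !linearZ /= diag_partK.
  by rewrite diag_part_neq // !linear0 addr0.
have [b ub] := absorb 1; rewrite scale1r in ub.
have b_neq0 : b != 0.
  by apply: contraNneq nzX => b0; rewrite ub b0 scale0r.
(* [v] is a multiple of [u], so some combination [u + c *: v] vanishes. *)
have bv : b *: v = (1 - b) *: u.
  by apply/eqP; rewrite scalerBl scale1r eq_sym subr_eq addrC -scalerDr -ub.
have b_neq1 : 1 - b != 0.
  apply: contraNneq nzY => b1; move/eqP: bv.
  by rewrite b1 scale0r scaler_eq0 (negbTE b_neq0).
have [d ud] := absorb (- (b / (1 - b))).
move: ud; rewrite scaleNr mulrC -scalerA bv scalerA mulVf // scale1r subrr.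
by rewrite scaler0 => u0; rewrite u0 eqxx in nzX.
Qed.

(** A matrix on diagonal [k] majorizes itself, so some probability vector fixes its image. That
    vector has weight 1 on every diagonal where the image is nonzero, so there cannot be two of
    them. *)
Lemma monomial_blocks_col T k l m : preserves_hc_maj T ->
  block T l k -> block T m k -> l = m.
Proof.
move=> presT /asboolP[X nzX] /asboolP[Y nzY]; apply/eqP.
apply: contraT => neq_lm.
(* A vector space is not the union of two proper subspaces: one of [X], [Y], [X + Y] works. *)
have [Z nzl nzm] : exists2 Z, diag_part l (T (diag_part k Z)) != 0
    & diag_part m (T (diag_part k Z)) != 0.
  have [mX0|] := eqVneq (diag_part m (T (diag_part k X))) 0; last by exists X.
  have [lY0|] := eqVneq (diag_part l (T (diag_part k Y))) 0; last by exists Y.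
  by exists (X + Y); rewrite !linearD /= ?mX0 ?lY0 ?addr0 ?add0r.
have /presT/hc_maj_partP[b [b_ge0 b_sum]] := hc_maj_diag_part k (diag_part k Z).
rewrite diag_partK => bE.
have b1 p : diag_part p (T (diag_part k Z)) != 0 -> b p = 1.
  move=> nzp; apply/eqP; rewrite -subr_eq0.
  have /eqP := bE p; rewrite -subr_eq0 -{1}[X in X - _]scale1r -scalerBl.
  by rewrite scaler_eq0 (negbTE nzp) orbF -opprB oppr_eq0.
move: b_sum; rewrite (bigD1 l) //= (bigD1 m) ?(eq_sym m) //= !b1 // => /eqP.
rewrite -subr_eq0 addrAC subrr add0r gt_eqF //.
by rewrite ltr_pwDl ?sumr_ge0.
Qed.

Lemma preserves_monomial_blocks T : preserves_hc_maj T -> monomial_blocks T.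
Proof.
move=> presT; split=> k l m.
  exact: monomial_blocks_row.
exact: monomial_blocks_col.
Qed.

(** * Consequences of monomial blocks *)

Lemma diag_part_image T l k Y : monomial_blocks T -> block T l k ->
  diag_part l (T Y) = diag_part l (T (diag_part k Y)).
Proof.
move=> [rowT _] blk; rewrite {1}[Y]sum_diag_part !linear_sum (bigD1 k) //=.
rewrite big1 ?addr0 // => m neq_mk; apply: block0.
by apply: contraNN neq_mk => /rowT/(_ blk) ->.
Qed.

Lemma diag_part_image0 T l Y :
  (forall k, ~~ block T l k) -> diag_part l (T Y) = 0.
Proof.
move=> nb; rewrite [Y]sum_diag_part !linear_sum big1 // => k _.
exact: block0.
Qed.

(** Read from left to right, this shows that the kernel of [T] is graded; from right to left, that
    the image is. *)
Lemma image_diag_part T l k Y : monomial_blocks T -> block T l k ->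
  T (diag_part k Y) = diag_part l (T Y).
Proof.
move=> monoT blk; rewrite (diag_part_image Y monoT blk).
rewrite {1}[T _]sum_diag_part (bigD1 l) //= big1 ?addr0 // => m neq_ml.
apply: block0; apply: contraNN neq_ml => bmk.
by rewrite (monoT.2 _ _ _ bmk blk).
Qed.

Lemma image_diag_part0 T k Y :
  (forall l, ~~ block T l k) -> T (diag_part k Y) = 0.
Proof.
move=> nb; rewrite [T _]sum_diag_part big1 // => l _; exact: block0.
Qed.

Lemma monomial_blocks_transfer T (a : 'I_n -> R) :
    monomial_blocks T -> prob_vector a ->
  exists2 b : 'I_n -> R,
    prob_vector b & forall l k, block T l k -> b l = a k.
Proof.
move=> [rowT colT] [a_ge0 a_sum].
pose c l := \sum_(k | block T l k) a k.
have cE l k : block T l k -> c l = a k.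
  move=> blk; rewrite /c (bigD1 k) //= big1 ?addr0 // => m /andP[blm].
  by rewrite (rowT _ _ _ blm blk) eqxx.
have c_ge0 l : 0 <= c l by apply: sumr_ge0.
have c_sum : \sum_l c l = \sum_k \sum_(l | block T l k) a k.
  by rewrite /c (exchange_big_dep xpredT).
(* If no block row is empty, sending a row to its block is an injection of a finite set into itself,
   so [c] is a permutation of [a] and already sums to 1. *)
have [/forallP full|] := boolP [forall l, [exists k, block T l k]].
  have /fin_all_exists[f blf] : forall l, exists k, block T l k.
    by move=> l; apply/existsP.
  have f_inj : injective f.
    by move=> l m eq_f; apply: (colT (f l)) => //; rewrite eq_f.
  exists c => //; split=> //; rewrite -a_sum [RHS](reindex_inj f_inj).
  by apply: eq_bigr => l _; apply: cE.
rewrite negb_forall => /existsP[l0]; rewrite negb_exists => /forallP nb0.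
have c_le1 : \sum_l c l <= 1.
  rewrite c_sum -a_sum; apply: ler_sum => k _.
  have [l blk|nb] := pickP (block T ^~ k); last by rewrite big_pred0.
  rewrite (bigD1 l) //= big1 ?addr0 // => m /andP[bmk].
  by rewrite (colT _ _ _ bmk blk) eqxx.
(* The empty block row [l0] absorbs the missing mass. *)
exists (fun l => c l + (l == l0)%:R * (1 - \sum_l c l)).
  split=> [l|]; first by rewrite addr_ge0 ?mulr_ge0 ?ler0n ?subr_ge0.
  rewrite big_split /= [X in _ + X](bigD1 l0) //= eqxx mul1r.
  rewrite [X in _ + (_ + X)]big1 ?addr0 ?subrKC // => l /negbTE ->.
  by rewrite mul0r.
move=> l k blk; have /negbTE-> : l != l0.
  by apply: contraTneq blk => ->.
by rewrite mul0r addr0; apply: cE.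
Qed.

Lemma monomial_blocks_preserves T : monomial_blocks T -> preserves_hc_maj T.
Proof.
move=> monoT X Y /hc_maj_partP[a a_prob XE]; apply/hc_maj_partP.
have [b b_prob bE] := monomial_blocks_transfer monoT a_prob.
exists b => // l.
have [k blk|nb] := pickP (block T l); last first.
  by rewrite !diag_part_image0 ?scaler0 // => k; rewrite nb.
rewrite (diag_part_image X monoT blk) (diag_part_image Y monoT blk) XE.
by rewrite (bE _ _ blk) !linearZ.
Qed.

(** * Block structure of the group inverse *)

Lemma block_group_inverse T U k l : monomial_blocks T ->
  is_group_inverse T U -> block U k l -> block T l k.
Proof.
move=> monoT [TUT UTU UT].
have {}TUT Z : T (U (T Z)) = T Z := TUT Z.
have {}UTU Z : U (T (U Z)) = U Z := UTU Z.
have {}UT Z : U (T Z) = T (U Z) := UT Z.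
(* The image and the kernel of [T] meet only in 0. *)
have ker_im Z : T (T Z) = 0 -> T Z = 0.
  by move=> TTZ; rewrite -TUT -UT TTZ linear0.
have im_graded m Z : exists Z', diag_part m (T Z) = T Z'.
  have [p bmp|nb] := pickP (block T m).
    by exists (diag_part p Z); rewrite (image_diag_part Z monoT bmp).
  by exists 0; rewrite linear0 diag_part_image0 // => p; rewrite nb.
have ker_graded m Z : T Z = 0 -> T (diag_part m Z) = 0.
  move=> TZ; have [p bpm|nb] := pickP (block T ^~ m).
    by rewrite (image_diag_part Z monoT bpm) TZ linear0.
  by rewrite image_diag_part0 // => p; rewrite nb.
(* [T \o U] is the projection onto the image along the kernel, both graded. As [v] has no [m]-part,
   the [m]-parts of [T (U v)] and of [v - T (U v)] are opposite, so they lie in both image and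
   kernel. *)
have TU_graded m w : m != l -> diag_part m (T (U (diag_part l w))) = 0.
  move=> neq_ml; set v := diag_part l w.
  have [Z ZE] := im_graded m (U v); rewrite ZE; apply: ker_im; rewrite -ZE.
  have : T (diag_part m (v - T (U v))) = 0.
    by apply: ker_graded; rewrite linearB /= -[T (U v)]UT TUT subrr.
  rewrite linearB /= diag_part_neq // sub0r linearN => /eqP.
  by rewrite oppr_eq0 => /eqP.
move=> bU; apply: contraT => nb; move: bU => /asboolP[w].
set x := U (diag_part l w); case/eqP.
(* Since [x = T (U x)], its [k]-part lies in the image, so it is enough that [T] kills it. If column
   [k] has a block, in row [m] say, then [T] sends this part to [diag_part m (T x)], and [m != l]
   because block [(l, k)] is assumed zero. *)
have [Z ZE] := im_graded k (U x).
have xE : T (U x) = x by rewrite -UT UTU.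
rewrite xE in ZE; rewrite ZE; apply: ker_im; rewrite -ZE.
have [m bmk|nbk] := pickP (block T ^~ k); last first.
  by rewrite image_diag_part0 // => p; rewrite nbk.
rewrite (image_diag_part _ monoT bmk) TU_graded //.
by apply: contraNneq nb => <-.
Qed.

Lemma monomial_blocks_group_inverse T U : monomial_blocks T ->
  is_group_inverse T U -> monomial_blocks U.
Proof.
move=> monoT invU.
have bU := block_group_inverse monoT invU.
split=> [l k m /bU blk /bU bml|k l m /bU bkl /bU bkm].
  exact: (monoT.2 l).
exact: (monoT.1 k).
Qed.

End DiagonalBlocks.

Theorem corollary2p7 (R : realType) (n : nat) (n_gt0 : (0 < n)%N)
    (T : {linear 'M[R]_n -> 'M[R]_n}) (hT : group_invertible T) :
  preserves_hc_maj T -> preserves_hc_maj (group_inverse hT).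
Proof.
move=> /preserves_monomial_blocks monoT; apply: monomial_blocks_preserves.
exact: monomial_blocks_group_inverse monoT (group_inverseP hT).
Qed.
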